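(* Let $p$ be an odd prime and let $G$ be a group of order $p^5$ which is not $p$-central and such that $|\Phi(G)|=p$. Then the transiso graph $\Gamma_p(G)$ is not complete.
   Context: $\Phi(G)$ denotes the Frattini subgroup of $G$. A finite $p$-group is not $p$-central if it has a subgroup of order $p$ not contained in its center. For a finite group $G$ and a subgroup $H\le G$, a normalized right transversal (NRT) of $H$ in $G$ is a subset $S\subseteq G$ with $1\in S$ containing exactly one element of each right coset of $H$ in $G$; $\mathcal{T}(G,H)$ denotes the set of all NRTs of $H$ in $G$. An NRT $S$ carries the induced binary operation $\circ$ defined by $\{x\circ y\}=S\cap Hxy$ for $x,y\in S$, which makes $S$ a right loop with identity $1$. Two NRTs $S,T$ (possibly of different subgroups) are isomorphic, $S\cong T$, if there is a bijection $S\to T$ preserving the induced operations. For a divisor $d$ of $|G|$, the transiso graph $\Gamma_d(G)$ is the simple graph whose vertices are the subgroups of $G$ of order $d$, and in which two distinct vertices $H_1,H_2$ are adjacent if and only if there exist $S_i\in\mathcal{T}(G,H_i)$ $(i=1,2)$ with $S_1\cong S_2$. A graph is complete if any two distinct vertices are adjacent. *)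

(* Defs.v *)
From mathcomp Require Import all_boot all_fingroup all_solvable.

Set Implicit Arguments.
Unset Strict Implicit.
Unset Printing Implicit Defensive.

Local Open Scope group_scope.

Definition p_central (gT : finGroupType) (p : nat) (G : {group gT}) : bool :=
  [forall H : {group gT}, (H \subset G) && (#|H| == p) ==> (H \subset 'Z(G))].

Section Transversals.

Variable gT : finGroupType.
Implicit Types (G H : {group gT}) (S T : {set gT}) (d : nat).

(* [rcosets H G] is the set of right cosets [H :* x] with [x \in G]. *)
Definition NRT G H : {set {set gT}} :=
  [set S : {set gT} | (1 \in S) && is_transversal S (rcosets H G) G].

(* The unique element of [S :&: H :* (x * y)] when [S \in NRT G H] and
   [x, y \in S]; see [nrt_opE]. *)
Definition nrt_op H S (x y : gT) : gT := repr (S :&: H :* (x * y)).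

Lemma nrt_opE G H S x y :
  S \in NRT G H -> x \in S -> y \in S ->
  [set nrt_op H S x y] = S :&: H :* (x * y).
Proof.
rewrite inE => /andP[_ /and3P[_ sSG /forall_inP trS]] Sx Sy.
have /trS/cards1P[z defz] : H :* (x * y) \in rcosets H G.
  by apply/rcosetsP; exists (x * y); rewrite ?groupM ?(subsetP sSG).
have : nrt_op H S x y \in S :&: H :* (x * y).
  by apply: (mem_repr z); rewrite defz set11.
by rewrite defz => /set1P->.
Qed.

(* The bijection [S -> T] is given as a function on [gT] of which only the
   restriction to [S] matters. *)
Definition nrt_isog H1 S H2 T : Prop :=
  exists f : gT -> gT,
    [/\ {in S &, injective f}, f @: S = T
      & {in S &, forall x y, f (nrt_op H1 S x y) = nrt_op H2 T (f x) (f y)}].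

Definition transiso_vertices d G : {set {group gT}} :=
  [set H : {group gT} | (H \subset G) && (#|H| == d)].

Definition transiso_adj G H1 H2 : Prop :=
  H1 != H2 /\
  exists S1 S2 : {set gT},
    [/\ S1 \in NRT G H1, S2 \in NRT G H2 & nrt_isog H1 S1 H2 S2].

Definition transiso_complete d G : Prop :=
  {in transiso_vertices d G &, forall H1 H2, H1 != H2 -> transiso_adj G H1 H2}.

End Transversals.

(* Main.v *)
Require Import Defs.
From mathcomp Require Import all_boot all_fingroup all_solvable.

(* Here G' = Phi(G) has order p and is central, and every NRT of the normal
   subgroup Phi(G) is a copy of the abelian group G / Phi(G). If some noncentral
   H of order p had an NRT isomorphic to it, that NRT would be associative, hence
   (H being core-free) an abelian subgroup S of order p^4 with G = HS; the
   centraliser in S of H is then central and has index at most |G'| = p in S,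
   so |Z(G)| >= p^3. As Mho^1(Z(G)) lies in Phi(G), Z(G) then has a subgroup K
   of order p other than Phi(G) = G'; since G / K is not abelian, K and Phi(G)
   are not adjacent. *)

Set Implicit Arguments.
Unset Strict Implicit.
Unset Printing Implicit Defensive.

Local Open Scope group_scope.

Section NRTTheory.

Variables (gT : finGroupType) (G : {group gT}).
Implicit Types (H K : {group gT}) (S T : {set gT}).

Lemma NRT1 H S : S \in NRT G H -> 1 \in S.
Proof. by rewrite inE => /andP[]. Qed.

Lemma NRT_sub H S : S \in NRT G H -> S \subset G.
Proof. by rewrite inE => /andP[_ /and3P[]]. Qed.

Lemma NRT_inj H S : S \in NRT G H -> {in S &, injective (rcoset H)}.
Proof.
move=> trS x y Sx Sy eqHxy; have := trS.
rewrite inE => /andP[_ /and3P[_ sSG /forall_inP trS1]].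
have /trS1/cards1P[z defz] : H :* x \in rcosets H G.
  by apply/rcosetsP; exists x; rewrite ?(subsetP sSG).
have : x \in S :&: H :* x by rewrite inE Sx rcoset_refl.
have : y \in S :&: H :* x by rewrite inE Sy -!rcosetE eqHxy rcosetE rcoset_refl.
by rewrite defz => /set1P-> /set1P->.
Qed.

Lemma NRT_repr H S x : S \in NRT G H -> x \in G ->
  exists2 s, s \in S & H :* x = H :* s.
Proof.
rewrite inE => /andP[_ /and3P[_ sSG /forall_inP trS1]] Gx.
have /trS1/cards1P[s defs] : H :* x \in rcosets H G by apply/rcosetsP; exists x.
have : s \in S :&: H :* x by rewrite defs set11.
by rewrite inE => /andP[Ss Hs]; exists s => //; apply/esym/rcoset_eqP.
Qed.

Lemma nrt_op_mem H S : S \in NRT G H ->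
  {in S &, forall x y, nrt_op H S x y \in S :&: H :* (x * y)}.
Proof. by move=> trS x y Sx Sy; rewrite -(nrt_opE trS) ?set11. Qed.

Lemma nrt_op_in H S : S \in NRT G H -> {in S &, forall x y, nrt_op H S x y \in S}.
Proof.
by move=> trS x y Sx Sy; move: (nrt_op_mem trS Sx Sy); rewrite inE => /andP[].
Qed.

Lemma rcoset_nrt_op H S : S \in NRT G H ->
  {in S &, forall x y, H :* nrt_op H S x y = H :* (x * y)}.
Proof.
move=> trS x y Sx Sy; move: (nrt_op_mem trS Sx Sy).
by rewrite inE => /andP[_ /rcoset_eqP].
Qed.

Lemma rcoset_nrt_opM H S : S \in NRT G H ->
  {in S &, forall x y z, H :* (nrt_op H S x y * z) = H :* (x * y * z)}.
Proof. by move=> trS x y Sx Sy z; rewrite !(rcosetM _ _ z) (rcoset_nrt_op trS). Qed.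

Definition nrt_comm H S :=
  {in S &, forall x y, nrt_op H S x y = nrt_op H S y x}.

Definition nrt_assoc H S :=
  {in S & &, forall x y z,
     nrt_op H S (nrt_op H S x y) z = nrt_op H S x (nrt_op H S y z)}.

Lemma nrt_isog_comm H S K T :
  nrt_isog H S K T -> S \in NRT G H -> nrt_comm H S -> nrt_comm K T.
Proof.
move=> [f [_ <- fM]] trS commS _ _ /imsetP[x Sx ->] /imsetP[y Sy ->].
by rewrite -!fM // commS.
Qed.

Lemma nrt_isog_assoc H S K T :
  nrt_isog H S K T -> S \in NRT G H -> nrt_assoc H S -> nrt_assoc K T.
Proof.
move=> [f [_ <- fM]] trS assS.
move=> _ _ _ /imsetP[x Sx ->] /imsetP[y Sy ->] /imsetP[z Sz ->].
by rewrite -!fM ?(nrt_op_in trS) // assS.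
Qed.

Lemma nrt_comm_der1 H S : S \in NRT G H -> G^`(1) \subset H -> nrt_comm H S.
Proof.
move=> trS sG'H x y Sx Sy.
apply: (NRT_inj trS); rewrite ?(nrt_op_in trS) // !rcosetE.
rewrite !(rcoset_nrt_op trS) //; apply/rcoset_eqP; rewrite mem_rcoset.
have [Gx Gy] : x \in G /\ y \in G by rewrite !(subsetP (NRT_sub trS)).
have -> : x * y * (y * x)^-1 = [~ x^-1, y^-1].
  by rewrite commgEl /conjg !invgK invMg !mulgA.
by apply: (subsetP sG'H); rewrite mem_commg ?groupV.
Qed.

(** As [x] normalises [H], the coset [H :* (x * u)] equals [x *: (H :* u)], so it depends on [u]
    only through its coset. *)
Lemma rcoset_norm_mull H x u v :
  x \in 'N(H) -> H :* u = H :* v -> H :* (x * u) = H :* (x * v).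
Proof. by move=> nHx equv; rewrite !rcosetM norm_rlcoset // -!mulgA equv. Qed.

(** Both bracketings represent the coset of [x * y * z]; for the right-hand one this uses that [x]
    normalises [H]. *)
Lemma nrt_assoc_normal H S : S \in NRT G H -> H <| G -> nrt_assoc H S.
Proof.
move=> trS /andP[_ nHG] x y z Sx Sy Sz.
have opS := nrt_op_in trS.
apply: (NRT_inj trS); rewrite ?opS // !rcosetE.
rewrite !(rcoset_nrt_op trS) ?opS // (rcoset_nrt_opM trS) // -mulgA.
have nHx : x \in 'N(H) by rewrite (subsetP nHG) ?(subsetP (NRT_sub trS)).
by apply: rcoset_norm_mull; rewrite // (rcoset_nrt_op trS).
Qed.

Lemma nrt_comm_normal_der1 H S :
  S \in NRT G H -> H <| G -> nrt_comm H S -> G^`(1) \subset H.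
Proof.
move=> trS /andP[_ nHG] commS; rewrite gen_subG.
apply/subsetP=> _ /imset2P[x y Gx Gy ->].
have [[s Ss eqx] [t St eqy]] := (NRT_repr trS Gx, NRT_repr trS Gy).
have sSG := subsetP (NRT_sub trS).
(* Cosets of a normal subgroup multiply, so commutation of representatives passes to all of [G]. *)
have Hmul u v s' t' : s' \in S -> H :* u = H :* s' -> H :* v = H :* t' ->
    H :* (u * v) = H :* (s' * t').
  move=> Ss' eu ev; rewrite rcosetM eu -rcosetM.
  by apply: rcoset_norm_mull; rewrite // (subsetP nHG) ?sSG.
have : H :* (x * y) = H :* (y * x).
  rewrite (Hmul x y s t) // (Hmul y x t s) //.
  by rewrite -!(rcoset_nrt_op trS) // commS.
move/rcoset_eqP; rewrite mem_rcoset => Hxy.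
(* The coset equality yields the commutator only up to conjugation, which normality of [H]
   absorbs. *)
have -> : [~ x, y] = (x * y * (y * x)^-1) ^ (y * x).
  by rewrite conjgE mulgKV invMg commgEl conjgE !mulgA.
by rewrite memJ_norm // (subsetP nHG) ?groupM.
Qed.

(* Associativity says that [y * z] and the product of [y] and [z] in [S] act
   alike on the right cosets of [H]; this action is faithful. *)
Lemma nrt_assoc_mulE H S : S \in NRT G H -> gcore H G = 1 ->
  nrt_assoc H S -> {in S &, forall y z, nrt_op H S y z = y * z}.
Proof.
move=> trS coreH1 assS y z Sy Sz; have opS := nrt_op_in trS.
apply/esym/eqP; rewrite eq_mulgV1 -in_set1 -[[set 1]]/(1 : {set gT}) -coreH1.
(* Lying in [H :^ g] means that [g * (y * z)] and [g * nrt_op H S y z] share a coset; [g] is then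
   replaced by its representative [s], to which associativity applies. *)
apply/bigcapP=> g Gg; rewrite mem_conjg.
have [s Ss eqs] := NRT_repr trS Gg.
have /rcoset_eqP: H :* (g * (y * z)) = H :* (g * nrt_op H S y z).
  rewrite !(rcosetM _ g) eqs -!rcosetM mulgA -(rcoset_nrt_opM trS) //.
  by rewrite -!(rcoset_nrt_op trS) ?opS // assS.
by rewrite mem_rcoset conjgE invMg invgK !mulgA.
Qed.

End NRTTheory.

Lemma NRT_mulG (gT : finGroupType) (G H : {group gT}) (S : {set gT}) :
  S \in NRT G H -> G \subset H * S.
Proof.
move=> trS; apply/subsetP=> g /(NRT_repr trS)[s Ss eqg].
by have := rcoset_refl H g; rewrite eqg => /rcosetP[h Hh ->]; rewrite mem_mulg.
Qed.

(** Orbit-stabiliser for [S] acting on [h] by conjugation: the conjugates [h * [~ h, s]] lie in one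
    coset of the derived subgroup, and ['C_S[h]] commutes with both [h] and [S], hence with [G]. *)
Lemma leq_card_center_abelian (gT : finGroupType) (G S : {group gT}) (h : gT) :
    h \in G -> S \subset G -> abelian S -> G \subset <[h]> * S ->
  #|S| <= #|G^`(1)| * #|'Z(G)|.
Proof.
move=> Gh sSG abS defG.
rewrite -(Lagrange (subcent1_sub h S)) mulnC index_cent1 leq_mul //.
  rewrite -(card_lcoset (G^`(1)) h) subset_leq_card //.
  apply/subsetP=> _ /imsetP[s Ss ->]; rewrite mem_lcoset -commgEl.
  by rewrite mem_commg // (subsetP sSG).
rewrite subset_leq_card // subsetI (subset_trans (subcent1_sub _ _) sSG) /=.
rewrite centsC (subset_trans defG) // mul_subG //.
  by rewrite cycle_subG -sub_cent1 subsetIr.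
by rewrite centsC (subset_trans (subcent1_sub _ _)).
Qed.

(** An abelian group has order [#|'Ohm_1|] times [#|'Mho^1|], and ['Mho^1('Z(G))] lies in
    ['Mho^1(G)], hence in ['Phi(G)]. *)
Lemma card_center_leq_Ohm1 (gT : finGroupType) (p : nat) (G : {group gT}) :
  p.-group G -> #|'Z(G)| <= #|'Ohm_1('Z(G))| * #|'Phi(G)|.
Proof.
move=> pG; rewrite -(mul_card_Ohm_Mho_abelian 1 (center_abelian G)).
rewrite leq_mul // subset_leq_card // (Phi_joing pG).
by rewrite (subset_trans _ (joing_subr _ _)) // MhoS ?center_sub.
Qed.

Theorem proposition3p12 (p : nat) (p_pr : prime p) (p_odd : odd p)
    (gT : finGroupType) (G : {group gT}) (oG : #|G| = (p ^ 5)%N)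
    (nG : ~~ p_central p G) (oPhi : #|'Phi(G)| = p) :
  ~ transiso_complete p G.
Proof.
move=> complG.
have pG : p.-group G by rewrite /pgroup oG pnatX pnat_id.
have nilG := pgroup_nil pG.
have p_gt1 := prime_gt1 p_pr.
have nsPhi : 'Phi(G) <| G := char_normal (Phi_char G).
have ntPhi : 'Phi(G) != 1 by rewrite -cardG_gt1 oPhi.
have prPhi : prime #|'Phi(G)| by rewrite oPhi.
have sPhiZ : 'Phi(G) \subset 'Z(G).
  exact: prime_meetG prPhi (meet_center_nil nilG nsPhi ntPhi).
have sG'Phi : G^`(1) \subset 'Phi(G) by rewrite (Phi_joing pG) joing_subl.
have vPhi : 'Phi(G)%G \in transiso_vertices p G.
  by rewrite inE Phi_sub oPhi eqxx.
have [H sHG [oH nHZ]] : exists2 H : {group gT},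
    H \subset G & #|H| = p /\ ~~ (H \subset 'Z(G)).
  case/forallPn: nG => H; rewrite negb_imply -andbA => /and3P[sHG /eqP oH nHZ].
  by exists H.
have prH : prime #|H| by rewrite oH.
have vH : H \in transiso_vertices p G by rewrite inE sHG oH eqxx.
(* A nontrivial core, being normal, would meet ['Z(G)], and [H], of prime order, would be
   central. *)
have coreH : gcore H G = 1.
  apply/eqP/idPn=> ntcore; case/negP: nHZ; apply: prime_meetG prH _.
  have := meet_center_nil nilG (gcore_normal sHG) ntcore.
  by apply: contraNneq => HZ1; rewrite -subG1 -HZ1 setSI ?gcore_sub.
(* [G] is not abelian because [H] is not central. *)
have eqG'Phi : G^`(1) = 'Phi(G).
  apply/eqP; rewrite eqEsubset sG'Phi; apply: prime_meetG prPhi _.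
  rewrite (setIidPr sG'Phi); apply: contraNneq nHZ => /derG1P abG.
  by rewrite (center_idP abG).
have ZG3 : p ^ 3 <= #|'Z(G)|.
  have neqHPhi : 'Phi(G)%G != H by apply: contraNneq nHZ => <-.
  have [_ [S [T [trS trT isoST]]]] := complG _ _ vPhi vH neqHPhi.
  have commT := nrt_isog_comm isoST trS (nrt_comm_der1 trS sG'Phi).
  have assT := nrt_isog_assoc isoST trS (nrt_assoc_normal trS nsPhi).
  have mulT := nrt_assoc_mulE trT coreH assT.
  have grT : group_set T.
    apply/group_setP; split=> [|x y Tx Ty]; first exact: NRT1 trT.
    by rewrite -mulT // (nrt_op_in trT).
  pose U := Group grT.
  have abU : abelian U.
    by apply/centsP=> x Tx y Ty; rewrite /commute -!mulT // commT.
  have /cyclicP[h defH] := prime_cyclic prH.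
  have Gh : h \in G by rewrite (subsetP sHG) // defH cycle_id.
  have leG := NRT_mulG trT; rewrite defH in leG.
  have := leq_card_center_abelian Gh (NRT_sub trT : U \subset G) abU leG.
  rewrite eqG'Phi oPhi => leU.
  (* Combined with [leU] this gives [p ^ 5 <= p * (p * #|'Z(G)|)], from which two factors [p]
     cancel. *)
  have : #|G| <= p * #|U|.
    rewrite -oH defH (leq_trans (subset_leq_card leG)) //.
    by rewrite mul_cardG leq_pmulr ?cardG_gt0.
  rewrite oG => leGU; have := leq_trans leGU (leq_mul (leqnn p) leU).
  by rewrite !(expnS p _.+1) !leq_pmul2l ?prime_gt0.
(* Otherwise [#|'Z(G)|] would be at most [p * p], below [p ^ 3]. *)
have [x /setDP[Ox Phi'x]] : exists x, x \in 'Ohm_1('Z(G)) :\: 'Phi(G).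
  apply/set0Pn; apply: contraL ZG3; rewrite setD_eq0 -ltnNge => sOPhi.
  apply: leq_ltn_trans (card_center_leq_Ohm1 pG) _.
  rewrite oPhi (@leq_ltn_trans (p ^ 2)) ?ltn_exp2l // -mulnn leq_mul //.
  by rewrite -oPhi subset_leq_card.
have Zx : x \in 'Z(G) by rewrite (subsetP (Ohm_sub 1 _)).
have pZ : p.-group 'Z(G) := pgroupS (center_sub G) pG.
have ox : #[x] = p.
  have /(abelemP p_pr)[_ xp1] := Ohm1_abelem pZ (center_abelian G).
  (* [x] is nontrivial because [1] lies in ['Phi(G)]. *)
  by apply: nt_prime_order; rewrite ?xp1 //; apply: contraNneq Phi'x => ->.
have sxZ : <[x]> \subset 'Z(G) by rewrite cycle_subG.
have vx : <[x]>%G \in transiso_vertices p G.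
  by rewrite inE (subset_trans sxZ (center_sub G)) -orderE ox eqxx.
have neqPhix : 'Phi(G)%G != <[x]>%G.
  by apply: contraNneq Phi'x => /(congr1 val) /= ->; exact: cycle_id.
(* Adjacency would make [T] commutative, forcing the derived subgroup ['Phi(G)] into [<[x]>]; equal
   orders then contradict [neqPhix]. *)
have [_ [S [T [trS trT isoST]]]] := complG _ _ vPhi vx neqPhix.
have nsx : <[x]> <| G := sub_center_normal sxZ.
have commT := nrt_isog_comm isoST trS (nrt_comm_der1 trS sG'Phi).
have := nrt_comm_normal_der1 trT nsx commT.
rewrite eqG'Phi => sPhix; case/eqP: neqPhix; apply/val_inj/eqP.
by rewrite /= eqEcard sPhix oPhi -orderE ox leqnn.
Qed.
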